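(* Let $\alpha,\beta\in\mathbb{R}$ with $\alpha\neq 0$, and let $G_1$ be the connected, simply connected three-dimensional Lie group with left-invariant Lorentzian metric $g$ whose Lie algebra has a pseudo-orthonormal basis $\{\widetilde e_1,\widetilde e_2,\widetilde e_3\}$, with $\widetilde e_3$ timelike, satisfying $$[\widetilde e_1,\widetilde e_2]=\alpha\widetilde e_1-\beta\widetilde e_3,\quad [\widetilde e_1,\widetilde e_3]=-\alpha\widetilde e_1-\beta\widetilde e_2,\quad [\widetilde e_2,\widetilde e_3]=\beta\widetilde e_1+\alpha\widetilde e_2+\alpha\widetilde e_3.$$ Let $\nabla^B$ be the Bott connection and $\widetilde\rho^B$ its symmetrized Ricci tensor. Then $(G_1,\nabla^B,\widetilde\rho^B)$ is not a quasi-statistical structure.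
   Context: Basis vectors are identified with left-invariant vector fields on the group $G$; $g(\widetilde e_1,\widetilde e_1)=g(\widetilde e_2,\widetilde e_2)=1$, $g(\widetilde e_3,\widetilde e_3)=-1$, and $g(\widetilde e_i,\widetilde e_j)=0$ for $i\ne j$. Let $\nabla^L$ be the Levi-Civita connection of $g$, $D=\mathrm{span}\{\widetilde e_1,\widetilde e_2\}$, $D^\perp=\mathrm{span}\{\widetilde e_3\}$ (distributions on $G$), with associated projections $\pi_D,\pi_{D^\perp}$ of $TG=D\oplus D^\perp$. The Bott connection $\nabla^B$ is the linear connection given by: $\nabla^B_XY=\pi_D(\nabla^L_XY)$ for $X,Y\in\Gamma^\infty(D)$; $\nabla^B_XY=\pi_D([X,Y])$ for $X\in\Gamma^\infty(D^\perp),Y\in\Gamma^\infty(D)$; $\nabla^B_XY=\pi_{D^\perp}([X,Y])$ for $X\in\Gamma^\infty(D),Y\in\Gamma^\infty(D^\perp)$; $\nabla^B_XY=\pi_{D^\perp}(\nabla^L_XY)$ for $X,Y\in\Gamma^\infty(D^\perp)$. Curvature: $R^B(X,Y)Z=\nabla^B_X\nabla^B_YZ-\nabla^B_Y\nabla^B_XZ-\nabla^B_{[X,Y]}Z$. Ricci tensor: $\rho^B(X,Y)=-g(R^B(X,\widetilde e_1)Y,\widetilde e_1)-g(R^B(X,\widetilde e_2)Y,\widetilde e_2)+g(R^B(X,\widetilde e_3)Y,\widetilde e_3)$. Symmetrized Ricci tensor: $\widetilde\rho^B(X,Y)=\tfrac12(\rho^B(X,Y)+\rho^B(Y,X))$.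 For a linear connection $\nabla$ with torsion $T(X,Y)=\nabla_XY-\nabla_YX-[X,Y]$ and a $(0,2)$ tensor field $\omega$, put $(\nabla_X\omega)(Y,Z)=X[\omega(Y,Z)]-\omega(\nabla_XY,Z)-\omega(Y,\nabla_XZ)$. The triple $(G,\nabla,\omega)$ is called a quasi-statistical structure if $(\nabla_X\omega)(Y,Z)-(\nabla_Y\omega)(X,Z)+\omega(T(X,Y),Z)=0$ for all vector fields $X,Y,Z$. *)

(* Defs.v *)
From HB Require Import structures.
From mathcomp Require Import all_boot all_order all_algebra.
From mathcomp Require Import ring.
From mathcomp Require Import all_classical all_reals all_analysis.

Set Implicit Arguments.
Unset Strict Implicit.
Unset Printing Implicit Defensive.

Import Order.TTheory GRing.Theory Num.Theory.
Import numFieldNormedType.Exports.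

Local Open Scope classical_set_scope.
Local Open Scope ring_scope.

Section smooth_on.
Context {R : realType} {V W : normedModType R}.
Implicit Types (U : set V) (f g : V -> W).

(* [k]-fold Frechet differentiability at the points of [U]; meant for open [U],
   where it only depends on the values of the function on [U]. *)
Fixpoint kdiff_on (k : nat) U f : Prop :=
  if k is k'.+1 then
    (forall x, U x -> differentiable f x) /\ (forall v, kdiff_on k' U ('D_v f))
  else True.

(* C^oo: a function that is differentiable k times has k - 1 continuous
   derivatives. *)
Definition smooth_on U f := forall k, kdiff_on k U f.

Lemma near_eq_differentiable f g x : {near x, f =1 g} ->
  differentiable f x -> differentiable g x.
Proof.
move=> fg /diff_locallyP[cd Ef].
have gx : g x = f x by rewrite (nbhs_singleton fg).
have Eg : g \o shift x = cst (g x) + 'd f x +o_ 0 id.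
  apply/eqaddoP => _/posnumP[e].
  have /eqaddoP/(_ e%:num) := Ef; move=> /(_ _)/wrap[//|] He.
  have fg0 : \forall h \near (0 : V), f (h + x) = g (h + x).
    by move: fg; rewrite (near_shift 0 x) subr0.
  apply: filterS2 fg0 He => h Eh; rewrite gx /=.
  by rewrite -[(g \o shift x - _) h]/(g (h + x) - (f x + 'd f x h)) -Eh.
have E := diff_unique cd Eg.
by apply/diff_locallyP; rewrite E.
Qed.

Lemma eq_kdiff_on k U f g : open U -> (forall x, U x -> f x = g x) ->
  kdiff_on k U f -> kdiff_on k U g.
Proof.
move=> oU; elim: k f g => [//|k IH] f g fg /= [df Df].
have nfg x : U x -> {near x, f =1 g}.
  by move=> Ux; apply: filterS fg _; exact: open_nbhs_nbhs.
split=> [x Ux|v]; first exact: near_eq_differentiable (nfg _ Ux) (df _ Ux).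
by apply: IH (Df v) => x Ux; apply: near_eq_derive; exact: nfg.
Qed.

Lemma kdiff_onS k U f : kdiff_on k.+1 U f -> kdiff_on k U f.
Proof.
elim: k f => [//|k IH] f [df Df]; split=> // v; exact/IH/Df.
Qed.

Lemma kdiff_on_cst k U (a : W) : open U -> kdiff_on k U (cst a).
Proof.
move=> oU; elim: k a => [//|k IH] a; split=> [x _|v].
  exact: differentiable_cst.
apply: (eq_kdiff_on oU _ (IH 0)) => x _.
by rewrite derive_cst.
Qed.

Lemma kdiff_onD k U f g : open U ->
  kdiff_on k U f -> kdiff_on k U g -> kdiff_on k U (f + g).
Proof.
move=> oU; elim: k f g => [//|k IH] f g [df Df] [dg Dg]; split=> [x Ux|v].
  by apply: differentiableD; [exact: df|exact: dg].
apply: (eq_kdiff_on oU _ (IH _ _ (Df v) (Dg v))) => x Ux.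
by rewrite deriveD//; apply: diff_derivable; [exact: df|exact: dg].
Qed.

Lemma kdiff_onZ k U (c : R) f : open U -> kdiff_on k U f ->
  kdiff_on k U (c *: f).
Proof.
move=> oU; elim: k f => [//|k IH] f [df Df]; split=> [x Ux|v].
  by apply: differentiableZ; exact: df.
apply: (eq_kdiff_on oU _ (IH _ (Df v))) => x Ux.
by rewrite deriveZ//; apply: diff_derivable; exact: df.
Qed.

End smooth_on.

Lemma kdiff_onM (R : realType) (V : normedModType R) k (U : set V)
    (f g : V -> R) : open U ->
  kdiff_on k U f -> kdiff_on k U g -> kdiff_on k U (f * g).
Proof.
move=> oU; elim: k f g => [//|k IH] f g Hf Hg.
have [df Df] := Hf; have [dg Dg] := Hg; split=> [x Ux|v].
  by apply: differentiableM; [exact: df|exact: dg].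
have H := kdiff_onD oU (IH _ _ (kdiff_onS Hf) (Dg v))
  (IH _ _ (kdiff_onS Hg) (Df v)).
apply: (eq_kdiff_on oU _ H) => x Ux.
by rewrite deriveM//; apply: diff_derivable; [exact: df|exact: dg].
Qed.

(* A homeomorphism from an open subset of [M] onto an open subset of R^n.
   [chart_map] and [chart_inv] are total; their values outside [chart_dom] and
   [chart_im] are irrelevant. *)
Record chart (R : realType) (n : nat) (M : topologicalType) := Chart {
  chart_dom : set M ;
  chart_im : set 'rV[R]_n ;
  chart_map : M -> 'rV[R]_n ;
  chart_inv : 'rV[R]_n -> M ;
  chart_dom_open : open chart_dom ;
  chart_im_open : open chart_im ;
  chart_mapP : forall x, chart_dom x -> chart_im (chart_map x) ;
  chart_invP : forall u, chart_im u -> chart_dom (chart_inv u) ;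
  chart_mapK : forall x, chart_dom x -> chart_inv (chart_map x) = x ;
  chart_invK : forall u, chart_im u -> chart_map (chart_inv u) = u ;
  chart_map_continuous : {within chart_dom, continuous chart_map} ;
  chart_inv_continuous : {within chart_im, continuous chart_inv} }.

HB.mixin Record isSmoothManifold (R : realType) (n : nat) M
    & Topological M := {
  atlas : set (chart R n M) ;
  manifold_hausdorff : hausdorff_space M ;
  manifold_second_countable : @second_countable M ;
  atlas_cover : forall x : M, exists2 c, atlas c & chart_dom c x ;
  atlas_compatible : forall c d, atlas c -> atlas d ->
    smooth_on [set u | chart_im c u /\ chart_dom d (chart_inv c u)]
      (fun u => chart_map d (chart_inv c u)) }.

#[short(type="smoothManifoldType")]
HB.structure Definition SmoothManifold (R : realType) (n : nat) :=
  {M of Topological M & isSmoothManifold R n M}.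

HB.mixin Record isLieGroup (R : realType) (n : nat) G
    & SmoothManifold R n G & Group G := {
  mulg_continuous : continuous (fun p : G * G => (p.1 * p.2)%g) ;
  invg_continuous : continuous (fun x : G => (x^-1)%g) ;
  mulg_smooth : forall c d k : chart R n G, atlas c -> atlas d -> atlas k ->
    smooth_on
      [set p : 'rV[R]_n * 'rV[R]_n | [/\ chart_im c p.1, chart_im d p.2
         & chart_dom k (chart_inv c p.1 * chart_inv d p.2)%g]]
      (fun p => chart_map k (chart_inv c p.1 * chart_inv d p.2)%g) ;
  invg_smooth : forall c d : chart R n G, atlas c -> atlas d ->
    smooth_on [set u | chart_im c u /\ chart_dom d (chart_inv c u)^-1%g]
      (fun u => chart_map d (chart_inv c u)^-1%g) }.

#[short(type="lieGroupType")]
HB.structure Definition LieGroup (R : realType) (n : nat) :=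
  {G of SmoothManifold R n G & Group G & isLieGroup R n G}.

Definition simply_connected (R : realType) (T : topologicalType) : Prop :=
  (forall x y : T, exists gamma : R -> T,
     [/\ {within `[0, 1], continuous gamma}, gamma 0 = x & gamma 1 = y]) /\
  (forall gamma : R -> T, {within `[0, 1], continuous gamma} ->
     gamma 0 = gamma 1 ->
     exists H : R * R -> T,
       [/\ {within `[0, 1] `*` `[0, 1], continuous H},
           forall t, t \in `[0, 1] -> H (0, t) = gamma t,
           forall t, t \in `[0, 1] -> H (1, t) = gamma 0
         & forall s, s \in `[0, 1] -> H (s, 0) = gamma 0 /\ H (s, 1) = gamma 0]).

Section smooth_fun.
Context {R : realType} {n : nat} (M : smoothManifoldType R n).

Definition is_smooth (f : M -> R) : Prop :=
  forall c, atlas c -> smooth_on (chart_im c) (f \o chart_inv c).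

Definition smooth_pred : {pred M -> R} := mem [set f | is_smooth f].

(* C^oo(M) *)
Record smooth_fun := SmoothFun {
  smooth_val :> M -> R ;
  smooth_valP : smooth_val \in smooth_pred }.

HB.instance Definition _ := [isSub for smooth_val].
HB.instance Definition _ := [Choice of smooth_fun by <:].

Lemma smooth_subring_closed : subring_closed smooth_pred.
Proof.
split=> [|f g|f g]; rewrite !inE/=.
- by move=> c _ k; apply: kdiff_on_cst; exact: chart_im_open.
- move=> Hf Hg c ac k.
  have -> : (f - g) \o chart_inv c =
      f \o chart_inv c + (-1 : R) *: (g \o chart_inv c).
    by rewrite scaleN1r.
  apply: kdiff_onD; [exact: chart_im_open|exact: Hf|].
  by apply: kdiff_onZ; [exact: chart_im_open|exact: Hg].
- move=> Hf Hg c ac k.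
  by apply: kdiff_onM; [exact: chart_im_open|exact: Hf|exact: Hg].
Qed.

HB.instance Definition _ :=
  GRing.isSubringClosed.Build (M -> R) smooth_pred smooth_subring_closed.
HB.instance Definition _ := GRing.SubChoice_isSubComPzRing.Build _ _ smooth_fun
  (GRing.subringClosedP smooth_pred).

Lemma smooth_scaler_closed : GRing.scaler_closed (R := R) smooth_pred.
Proof.
move=> a f; rewrite !inE/= => Hf c ac k.
by apply: kdiff_onZ; [exact: chart_im_open|exact: Hf].
Qed.

HB.instance Definition _ :=
  GRing.isScaleClosed.Build R (M -> R) smooth_pred smooth_scaler_closed.
HB.instance Definition _ := [SubZmodule_isSubLmodule of smooth_fun by <:].

Definition smooth_cst (a : R) : smooth_fun := a *: (1 : smooth_fun).

End smooth_fun.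

Section vector_field.
Context {R : realType} {n : nat} (M : smoothManifoldType R n).
Implicit Types (f h : smooth_fun M).

Definition is_derivation (X : smooth_fun M -> smooth_fun M) : Prop :=
  (forall (a : R) f h, X (a *: f + h) = a *: X f + X h) /\
  (forall f h, X (f * h) = X f * h + f * X h).

Definition derivation_pred : {pred smooth_fun M -> smooth_fun M} :=
  mem [set X | is_derivation X].

(* Smooth vector fields on [M], as derivations of C^oo(M). *)
Record vector_field := VectorField {
  vf_fun :> smooth_fun M -> smooth_fun M ;
  vf_funP : vf_fun \in derivation_pred }.

HB.instance Definition _ := [isSub for vf_fun].
HB.instance Definition _ := [Choice of vector_field by <:].

Implicit Types (X Y : vector_field).

Lemma vf_derivation X : is_derivation X.
Proof. exact: set_mem (vf_funP X). Qed.

Lemma vfP X Y : (forall f, X f = Y f) -> X = Y.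
Proof. by move=> XY; apply/val_inj/funext. Qed.

Lemma vfL X (a : R) f h : X (a *: f + h) = a *: X f + X h.
Proof. by have [] := vf_derivation X. Qed.

Lemma vfM X f h : X (f * h) = X f * h + f * X h.
Proof. by have [] := vf_derivation X. Qed.

Lemma vfD X f h : X (f + h) = X f + X h.
Proof. by rewrite -{1}[f]scale1r vfL scale1r. Qed.

Lemma vfB X f h : X (f - h) = X f - X h.
Proof. by rewrite addrC -scaleN1r vfL scaleN1r addrC. Qed.

Lemma vfZ X (a : R) f : X (a *: f) = a *: X f.
Proof.
have X0 : X 0 = 0 by have := vfB X 0 0; rewrite !subrr.
by rewrite -[a *: f]addr0 vfL X0 addr0.
Qed.

Lemma derivation_zmod_closed : zmod_closed derivation_pred.
Proof.
split=> [|X Y]; rewrite !inE/=.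
  split=> [a f h|f h].
    by rewrite -[RHS]/(a *: 0 + 0) scaler0 addr0.
  by rewrite -[RHS]/(0 * h + f * 0) mul0r mulr0 addr0.
move=> [XL XM] [YL YM]; split=> [a f h|f h].
  rewrite -[(X - Y) (a *: f + h)]/(X (a *: f + h) - Y (a *: f + h)).
  rewrite -[(X - Y) f]/(X f - Y f) -[(X - Y) h]/(X h - Y h).
  by rewrite XL YL scalerBr opprD addrACA.
rewrite -[(X - Y) (f * h)]/(X (f * h) - Y (f * h)).
rewrite -[(X - Y) f]/(X f - Y f) -[(X - Y) h]/(X h - Y h).
by rewrite XM YM mulrBl mulrBr opprD addrACA.
Qed.

HB.instance Definition _ :=
  GRing.isZmodClosed.Build _ derivation_pred derivation_zmod_closed.
HB.instance Definition _ := [SubChoice_isSubZmodule of vector_field by <:].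

Lemma vf_scale_subproof f X : (fun h => f * X h) \in derivation_pred.
Proof.
apply/mem_set; split=> [a h k|h k] /=.
  rewrite vfL mulrDr; congr (_ + _).
  apply/val_inj/funext => x.
  rewrite -[LHS]/(f x * (a * X h x)) -[RHS]/(a * (f x * X h x)).
  by rewrite mulrCA.
by rewrite vfM mulrDr mulrA; congr (_ + _); rewrite mulrCA.
Qed.

Definition vf_scale f X : vector_field := VectorField (vf_scale_subproof f X).

Lemma vf_scaleA f h X : vf_scale f (vf_scale h X) = vf_scale (f * h) X.
Proof. by apply: vfP => k /=; rewrite mulrA. Qed.

Lemma vf_scale1 : left_id 1 vf_scale.
Proof. by move=> X; apply: vfP => k /=; rewrite mul1r. Qed.

Lemma vf_scaleDr : right_distributive vf_scale +%R.
Proof. by move=> f X Y; apply: vfP => k; apply: mulrDr. Qed.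

Lemma vf_scaleDl X : {morph vf_scale^~ X : f h / f + h}.
Proof. by move=> f h; apply: vfP => k; apply: mulrDl. Qed.

HB.instance Definition _ := GRing.Zmodule_isLmodule.Build (smooth_fun M)
  vector_field vf_scaleA vf_scale1 vf_scaleDr vf_scaleDl.

Lemma lie_bracket_subproof X Y :
  (fun f => X (Y f) - Y (X f)) \in derivation_pred.
Proof.
apply/mem_set; split=> [a f h|f h].
  by rewrite !vfL scalerBr opprD addrACA.
rewrite !(vfM, vfD).
ring.
Qed.

Definition lie_bracket X Y : vector_field :=
  VectorField (lie_bracket_subproof X Y).

End vector_field.

Section connections.
Context {R : realType} {n : nat} {M : smoothManifoldType R n}.
Local Notation VF := (vector_field M).
Local Notation C := (smooth_fun M).
Implicit Types (X Y Z : VF) (f : C) (nabla : VF -> VF -> VF).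

Definition tensor02 (w : VF -> VF -> C) : Prop :=
  (forall f X Y Z, w (f *: X + Y) Z = f * w X Z + w Y Z) /\
  (forall f X Y Z, w X (f *: Y + Z) = f * w X Y + w X Z).

(* [E] is a pseudo-orthonormal basis at [x] of signature (+, ..., +, -), the
   tangent space at [x] being the space of values at [x] of vector fields. *)
Definition lorentz_basis_at (g : VF -> VF -> C) (x : M) (E : 'I_n -> VF) : Prop :=
  (forall i j, g (E i) (E j) x =
     if i == j then (if i.+1 == n then -1 else 1) else 0) /\
  (forall X, exists c : 'I_n -> R,
     forall f, X f x = \sum_i c i * E i f x).

Definition lorentzian_metric (g : VF -> VF -> C) : Prop :=
  [/\ tensor02 g, forall X Y, g X Y = g Y X
    & forall x, exists E, lorentz_basis_at g x E].

Definition linear_connection nabla : Prop :=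
  [/\ forall f X Y Z, nabla (f *: X + Y) Z = f *: nabla X Z + nabla Y Z,
      forall X Y Z, nabla X (Y + Z) = nabla X Y + nabla X Z
    & forall X f Y, nabla X (f *: Y) = X f *: Y + f *: nabla X Y].

Definition torsion nabla X Y : VF := nabla X Y - nabla Y X - lie_bracket X Y.

Definition curvature nabla X Y Z : VF :=
  nabla X (nabla Y Z) - nabla Y (nabla X Z) - nabla (lie_bracket X Y) Z.

Definition covariant_derivative nabla (w : VF -> VF -> C) X Y Z : C :=
  X (w Y Z) - w (nabla X Y) Z - w Y (nabla X Z).

Definition levi_civita (g : VF -> VF -> C) nabla : Prop :=
  [/\ linear_connection nabla,
      forall X Y, torsion nabla X Y = 0
    & forall X Y Z, covariant_derivative nabla g X Y Z = 0].

Definition quasi_statistical nabla (w : VF -> VF -> C) : Prop :=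
  forall X Y Z, covariant_derivative nabla w X Y Z -
    covariant_derivative nabla w Y X Z + w (torsion nabla X Y) Z = 0.

(* Projections of TM = D (+) D', where [D] and [D'] stand for the sets of
   sections of the two distributions. *)
Definition splitting (D D' : set VF) (piD piD' : VF -> VF) : Prop :=
  (forall X, [/\ D (piD X), D' (piD' X) & X = piD X + piD' X]) /\
  (forall Y Z, D Y -> D' Z -> piD (Y + Z) = Y /\ piD' (Y + Z) = Z).

Definition bott_connection (D D' : set VF) (piD piD' : VF -> VF)
    (nablaL nablaB : VF -> VF -> VF) : Prop :=
  linear_connection nablaB /\
  [/\ forall X Y, D X -> D Y -> nablaB X Y = piD (nablaL X Y),
      forall X Y, D' X -> D Y -> nablaB X Y = piD (lie_bracket X Y),
      forall X Y, D X -> D' Y -> nablaB X Y = piD' (lie_bracket X Y)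
    & forall X Y, D' X -> D' Y -> nablaB X Y = piD' (nablaL X Y)].

Definition span1 X : set VF := [set Z | exists f, Z = f *: X].
Definition span2 X Y : set VF :=
  [set Z | exists f h : C, Z = f *: X + h *: Y].

(* For a pseudo-orthonormal frame with [e3] timelike. *)
Definition ricci (g : VF -> VF -> C) nabla (e1 e2 e3 : VF) X Y : C :=
  - g (curvature nabla X e1 Y) e1 - g (curvature nabla X e2 Y) e2
  + g (curvature nabla X e3 Y) e3.

Definition sym_ricci (g : VF -> VF -> C) nabla (e1 e2 e3 : VF) X Y : C :=
  (2^-1 : R) *: (ricci g nabla e1 e2 e3 X Y + ricci g nabla e1 e2 e3 Y X).

End connections.

Section left_invariance.
Context {R : realType} {n : nat} {G : lieGroupType R n}.
Local Notation VF := (vector_field G).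

(* [X'] is related to [X] by the left translation by [a], i.e. [X'] is the
   pushforward of [X]; [h] is the composition of [f] with this translation. *)
Definition ltrans_related (a : G) (X X' : VF) : Prop :=
  forall f h : smooth_fun G, (forall x, h x = f (a * x)%g) ->
  forall x, X h x = X' f (a * x)%g.

Definition left_invariant (X : VF) : Prop := forall a, ltrans_related a X X.

Definition left_invariant_metric (g : VF -> VF -> smooth_fun G) : Prop :=
  forall a X X' Y Y', ltrans_related a X X' -> ltrans_related a Y Y' ->
  forall x, g X' Y' (a * x)%g = g X Y x.

Definition lie_algebra_basis (e : n.-tuple VF) : Prop :=
  (forall i, left_invariant (tnth e i)) /\
  (forall X, left_invariant X ->
     exists! c : 'rV[R]_n, X = \sum_i smooth_cst G (c 0 i) *: tnth e i).

End left_invariance.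

(* Main.v *)
Require Import Defs.
From HB Require Import structures.
From mathcomp Require Import all_boot all_order all_algebra.
From mathcomp Require Import ring.
From mathcomp Require Import all_classical all_reals all_analysis.

Import Order.TTheory GRing.Theory Num.Theory.
Import numFieldNormedType.Exports.
Local Open Scope classical_set_scope.
Local Open Scope ring_scope.

(** The quasi-statistical condition is an identity for all vector fields, so it
    is enough to violate it on one triple of frame fields. On (e1, e3, e1) its
    left-hand side is the constant -(3/2) alpha^3 (lemma [bott_codazzi_defect]),
    which is nonzero because alpha is.

    To find this constant, write everything in the left-invariant frame. The
    Bott connection has constant coefficients there (lemma [bott_frame]): part
    of them are components of the Lie brackets, the others come from the
    Levi-Civita connection through metric compatibility and vanishing torsion.
    Its curvature (lemma [bott_curvature_frame]) and Ricci tensor (lemma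
    [bott_ricci_frame]) are then polynomials in alpha and beta. Writing r for
    the symmetrized Ricci tensor, its components are constant, so their
    derivatives drop out, and the torsion merges with the connection terms into
    the bracket:

      - r([e1,e3], e1) - r(e3, B_e1 e1) + r(e1, B_e3 e1)
        = 2 alpha r11 + 2 beta r12 + alpha r23,

    with r11 = -(alpha^2 + beta^2), r12 = alpha beta and r23 = alpha^2 / 2. *)

(** * Derivations of the ring of smooth functions *)

Section VectorFields.
Context {R : realType} {n : nat} {M : smoothManifoldType R n}.
Local Notation VF := (vector_field M).
Local Notation C := (smooth_fun M).
Implicit Types (X Y Z : VF) (f h : C) (r : R).

Lemma vf_addE X Y f : (X + Y) f = X f + Y f.
Proof. by []. Qed.

Lemma vf_oppE X f : (- X) f = - X f.
Proof.
by apply: (addrI (X f)); rewrite -vf_addE !subrr.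
Qed.

Lemma vf_scaleE f X h : (f *: X) h = f * X h.
Proof. by []. Qed.

Lemma vf_zeroE f : (0 : VF) f = 0.
Proof. by []. Qed.

Lemma lie_bracketE X Y f : lie_bracket X Y f = X (Y f) - Y (X f).
Proof. by []. Qed.

Lemma vf_opp X f : X (- f) = - X f.
Proof. by rewrite -scaleN1r vfZ scaleN1r. Qed.

(** Evaluating both sides of an identity between vector fields on a smooth
    function turns it into a polynomial identity in the ring C^oo(M); this is
    how every module identity below is reduced to [ring]. *)
Definition vfE := (vf_addE, vf_oppE, vf_scaleE, vf_zeroE, lie_bracketE,
  @vfD R n M, @vfM R n M, vf_opp).

Lemma lie_bracket_leibniz f X Y Z :
  lie_bracket (f *: X + Y) Z =
    f *: lie_bracket X Z - Z f *: X + lie_bracket Y Z.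
Proof. by apply: vfP => h; rewrite !vfE; ring. Qed.

Lemma lie_bracket_skew X Y : lie_bracket X Y = - lie_bracket Y X.
Proof. by apply: vfP => h; rewrite !vfE; ring. Qed.

Lemma lie_bracket_diag X : lie_bracket X X = 0.
Proof. by apply: vfP => h; rewrite !vfE; ring. Qed.

Lemma smooth_cstE r x : smooth_cst M r x = r.
Proof. exact: mulr1. Qed.

Lemma smooth_cst_scale r f : r *: f = smooth_cst M r * f.
Proof.
by apply/val_inj/funext => x; rewrite -[RHS]/(r * 1 * f x) mulr1.
Qed.

Lemma vf_0 X : X 0 = 0.
Proof. by have := vfB X 0 0; rewrite !subrr. Qed.

Lemma vf_1 X : X 1 = 0.
Proof.
have := vfM X 1 1; rewrite !mulr1 mul1r => E.
by apply: (addrI (X 1)); rewrite addr0 -E.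
Qed.

Lemma vf_cst X r : X (smooth_cst M r) = 0.
Proof. by rewrite vfZ vf_1 scaler0. Qed.

(** C^oo(M) is an algebra over the reals, hence has no 2-torsion. *)
Lemma smooth_double_eq0 f : f + f = 0 -> f = 0.
Proof.
move=> E; rewrite -[f]scale1r.
have -> : 1 = 2^-1 + 2^-1 :> R by field.
by rewrite scalerDl -scalerDr E scaler0.
Qed.

End VectorFields.

(** * Tensors of type (0,2) *)

Section Tensors.
Context {R : realType} {n : nat} {M : smoothManifoldType R n}.
Local Notation VF := (vector_field M).
Local Notation C := (smooth_fun M).
Context {w : VF -> VF -> C} (w_tensor : tensor02 w).
Implicit Types (X Y Z : VF) (f : C).

Lemma tensor_addl X Y Z : w (X + Y) Z = w X Z + w Y Z.
Proof. by have := w_tensor.1 1 X Y Z; rewrite scale1r mul1r. Qed.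

Lemma tensor_addr X Y Z : w X (Y + Z) = w X Y + w X Z.
Proof. by have := w_tensor.2 1 X Y Z; rewrite scale1r mul1r. Qed.

Lemma tensor_0l Z : w 0 Z = 0.
Proof. by apply: (addrI (w 0 Z)); rewrite -tensor_addl !addr0. Qed.

Lemma tensor_0r X : w X 0 = 0.
Proof. by apply: (addrI (w X 0)); rewrite -tensor_addr !addr0. Qed.

Lemma tensor_scalel f X Z : w (f *: X) Z = f * w X Z.
Proof. by have := w_tensor.1 f X 0 Z; rewrite addr0 tensor_0l addr0. Qed.

Lemma tensor_scaler f X Y : w X (f *: Y) = f * w X Y.
Proof. by have := w_tensor.2 f X Y 0; rewrite addr0 tensor_0r addr0. Qed.

Lemma tensor_oppl X Z : w (- X) Z = - w X Z.
Proof. by rewrite -scaleN1r tensor_scalel mulN1r. Qed.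

Lemma tensor_oppr X Y : w X (- Y) = - w X Y.
Proof. by rewrite -scaleN1r tensor_scaler mulN1r. Qed.

Definition tensorE := (tensor_addl, tensor_addr, tensor_scalel, tensor_scaler,
  tensor_oppl, tensor_oppr, tensor_0l, tensor_0r).

End Tensors.

(** * Linear connections and their curvature *)

Section LinearConnections.
Context {R : realType} {n : nat} {M : smoothManifoldType R n}.
Local Notation VF := (vector_field M).
Local Notation C := (smooth_fun M).
Context {nabla : VF -> VF -> VF} (nabla_linear : linear_connection nabla).
Implicit Types (X Y Z : VF) (f : C).

Lemma connection_addl X Y Z : nabla (X + Y) Z = nabla X Z + nabla Y Z.
Proof.
by have [H _ _] := nabla_linear; have := H 1 X Y Z; rewrite !scale1r.
Qed.

Lemma connection_0l Z : nabla 0 Z = 0.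
Proof. by apply: (addrI (nabla 0 Z)); rewrite -connection_addl !addr0. Qed.

Lemma connection_scalel f X Z : nabla (f *: X) Z = f *: nabla X Z.
Proof.
by have [H _ _] := nabla_linear; have := H f X 0 Z; rewrite connection_0l !addr0.
Qed.

Lemma connection_oppl X Z : nabla (- X) Z = - nabla X Z.
Proof. by rewrite -scaleN1r connection_scalel scaleN1r. Qed.

Lemma connection_addr X Y Z : nabla X (Y + Z) = nabla X Y + nabla X Z.
Proof. by have [_ H _] := nabla_linear. Qed.

Lemma connection_leibniz X f Y : nabla X (f *: Y) = X f *: Y + f *: nabla X Y.
Proof. by have [_ _ H] := nabla_linear. Qed.

Lemma connection_0r X : nabla X 0 = 0.
Proof. by apply: (addrI (nabla X 0)); rewrite -connection_addr !addr0. Qed.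

Lemma connection_oppr X Y : nabla X (- Y) = - nabla X Y.
Proof.
by apply: (addrI (nabla X Y)); rewrite -connection_addr !subrr connection_0r.
Qed.

Definition connectionE := (connection_addl, connection_scalel, connection_oppl,
  connection_0l, connection_addr, connection_leibniz, connection_oppr,
  connection_0r).

Lemma torsion_eq0 X Y : torsion nabla X Y = 0 ->
  nabla X Y = nabla Y X + lie_bracket X Y.
Proof.
by move/eqP; rewrite /torsion subr_eq0 => /eqP <-; rewrite addrC subrK.
Qed.

Lemma curvature_skew X Y Z :
  curvature nabla X Y Z = - curvature nabla Y X Z.
Proof.
rewrite /curvature (lie_bracket_skew X Y) connection_oppl.
by apply: vfP => h; rewrite !vfE; ring.
Qed.

Lemma curvature_diag X Z : curvature nabla X X Z = 0.
Proof. by rewrite /curvature lie_bracket_diag connection_0l !subrr. Qed.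

(** The derivative of [f] produced by [nabla W (f *: _)] is cancelled by the one
    hidden in [lie_bracket (f *: X) W]. *)
Lemma curvature_linear1 f X Y W Z :
  curvature nabla (f *: X + Y) W Z =
    f *: curvature nabla X W Z + curvature nabla Y W Z.
Proof.
rewrite /curvature lie_bracket_leibniz !connectionE.
by apply: vfP => h; rewrite !vfE; ring.
Qed.

(** The first derivatives of [f] cancel by antisymmetry in [X] and [W]; the
    second ones add up to the commutator of [X] and [W] acting on [f], which the
    term in [lie_bracket X W] removes. *)
Lemma curvature_linear3 f X W Y Z :
  curvature nabla X W (f *: Y + Z) =
    f *: curvature nabla X W Y + curvature nabla X W Z.
Proof.
rewrite /curvature !connectionE.
by apply: vfP => h; rewrite !vfE; ring.
Qed.

Lemma ricci_tensor (g : VF -> VF -> C) (e1 e2 e3 : VF) :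
  tensor02 g -> tensor02 (ricci g nabla e1 e2 e3).
Proof.
move=> gT; split=> f X Y Z; rewrite /ricci.
  by rewrite !curvature_linear1 !(tensorE gT); ring.
by rewrite !curvature_linear3 !(tensorE gT); ring.
Qed.

(** With this, the quasi-statistical condition on a frame becomes a
    combination of the components of the Ricci tensor on that frame. *)
Lemma sym_ricci_tensor (g : VF -> VF -> C) (e1 e2 e3 : VF) :
  tensor02 g -> tensor02 (sym_ricci g nabla e1 e2 e3).
Proof.
move=> /(ricci_tensor g e1 e2 e3) ricT.
by split=> f X Y Z; rewrite /sym_ricci !(tensorE ricT) !smooth_cst_scale; ring.
Qed.

End LinearConnections.

(** * Connections compatible with a metric *)

Section MetricConnections.
Context {R : realType} {n : nat} {M : smoothManifoldType R n}.
Local Notation VF := (vector_field M).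
Local Notation C := (smooth_fun M).
Context {g : VF -> VF -> C} {nabla : VF -> VF -> VF}.
Hypothesis g_sym : forall X Y, g X Y = g Y X.
Hypothesis g_parallel : forall X Y Z, covariant_derivative nabla g X Y Z = 0.
Implicit Types (X Y Z : VF).

(** When the inner product of two fields is constant along [X], as for two
    members of a pseudo-orthonormal frame, differentiating it leaves only
    antisymmetry of the connection coefficients. *)
Lemma metric_skew X Y Z : X (g Y Z) = 0 -> g (nabla X Y) Z = - g (nabla X Z) Y.
Proof.
move=> E; have := g_parallel X Y Z.
rewrite /covariant_derivative E sub0r (g_sym Y) => /eqP.
by rewrite subr_eq0 => /eqP H; rewrite -H opprK.
Qed.

Lemma metric_diag X Y : X (g Y Y) = 0 -> g (nabla X Y) Y = 0.
Proof.
by move=> E; apply: smooth_double_eq0; rewrite {1}metric_skew ?E// addNr.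
Qed.

End MetricConnections.

(** * Projections in a Lorentzian frame *)

Section LorentzFrame.
Context {R : realType} {n : nat} {M : smoothManifoldType R n}.
Local Notation VF := (vector_field M).
Local Notation C := (smooth_fun M).
Context {g : VF -> VF -> C} (gT : tensor02 g).
Hypothesis g_sym : forall X Y, g X Y = g Y X.
Context {e1 e2 e3 : VF}.
Hypotheses (g11 : g e1 e1 = 1) (g22 : g e2 e2 = 1) (g33 : g e3 e3 = -1)
  (g12 : g e1 e2 = 0) (g13 : g e1 e3 = 0) (g23 : g e2 e3 = 0).
Context {piD piDperp : VF -> VF}.
Hypothesis pi_splitting : splitting (span2 e1 e2) (span1 e3) piD piDperp.
Implicit Types (X : VF).

Let gE := (tensorE gT, g11, g22, g33, g12, g13, g23,
  g_sym e2 e1, g_sym e3 e1, g_sym e3 e2, mulr1, mulr0, addr0, add0r).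

(** Orthonormality reads off the coefficients of a decomposition; the minus
    sign comes from [e3] being timelike. *)
Lemma splitting_frame X :
  piD X = g X e1 *: e1 + g X e2 *: e2 /\ piDperp X = - g X e3 *: e3.
Proof.
have [[f [h ->]] [k ->] ->] := pi_splitting.1 X.
by rewrite !gE mulrN1 opprK.
Qed.

End LorentzFrame.

(** * The Bott connection of the Lie algebra of G1 *)

Section BottConnectionG1.
Context {R : realType} {n : nat} {M : smoothManifoldType R n}.
Local Notation VF := (vector_field M).
Local Notation C := (smooth_fun M).
Context {alpha beta : R}.
Local Notation a := (smooth_cst M alpha).
Local Notation b := (smooth_cst M beta).
Context {g : VF -> VF -> C} (gT : tensor02 g).
Hypothesis g_sym : forall X Y, g X Y = g Y X.
Context {e1 e2 e3 : VF}.
Hypotheses (g11 : g e1 e1 = 1) (g22 : g e2 e2 = 1) (g33 : g e3 e3 = -1)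
  (g12 : g e1 e2 = 0) (g13 : g e1 e3 = 0) (g23 : g e2 e3 = 0).
Hypotheses
  (bracket12 : lie_bracket e1 e2 = a *: e1 - b *: e3)
  (bracket13 : lie_bracket e1 e3 = - (a *: e1) - b *: e2)
  (bracket23 : lie_bracket e2 e3 = b *: e1 + a *: e2 + a *: e3).
Context {nablaL : VF -> VF -> VF} (nablaL_levi_civita : levi_civita g nablaL).
Context {piD piDperp : VF -> VF}.
Hypothesis pi_splitting : splitting (span2 e1 e2) (span1 e3) piD piDperp.
Context {B : VF -> VF -> VF}.
Hypothesis B_bott :
  bott_connection (span2 e1 e2) (span1 e3) piD piDperp nablaL B.

Let gE := (tensorE gT, g11, g22, g33, g12, g13, g23,
  g_sym e2 e1, g_sym e3 e1, g_sym e3 e2).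

Let bracket31 : lie_bracket e3 e1 = a *: e1 + b *: e2.
Proof. by rewrite lie_bracket_skew bracket13 opprB opprK addrC. Qed.

Let bracket32 : lie_bracket e3 e2 = - (b *: e1 + a *: e2 + a *: e3).
Proof. by rewrite lie_bracket_skew bracket23. Qed.

(** The Levi-Civita connection enters through the [D]-part of its values on
    [e1], [e2] and the [e3]-part of its value on [(e3, e3)]. Skew-symmetry kills or pairs these coefficients, and the two
    remaining ones, [g (nablaL e1 e2) e1] and [g (nablaL e2 e2) e1], follow from
    vanishing torsion and the bracket of [e1] and [e2]. *)
Lemma bott_frame :
  [/\ B e1 e1 = - a *: e2, B e1 e2 = a *: e1 & B e1 e3 = 0] /\
  [/\ B e2 e1 = 0, B e2 e2 = 0 & B e2 e3 = a *: e3] /\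
  [/\ B e3 e1 = a *: e1 + b *: e2, B e3 e2 = - b *: e1 - a *: e2
    & B e3 e3 = 0].
Proof.
have [_ torsion0 parallel] := nablaL_levi_civita.
have [_ [BDD BpD BDp Bpp]] := B_bott.
have D1 : span2 e1 e2 e1 by exists 1, 0; rewrite scale1r scale0r addr0.
have D2 : span2 e1 e2 e2 by exists 0, 1; rewrite scale1r scale0r add0r.
have D3 : span1 e3 e3 by exists 1; rewrite scale1r.
pose frameE := splitting_frame gT g_sym g11 g22 g33 g12 g13 g23 pi_splitting.
pose piDE X := (frameE X).1.
pose piDperpE X := (frameE X).2.
have dg1 X : g (nablaL X e1) e1 = 0.
  by apply: (metric_diag g_sym parallel); rewrite g11 vf_1.
have dg2 X : g (nablaL X e2) e2 = 0.
  by apply: (metric_diag g_sym parallel); rewrite g22 vf_1.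
have dg3 X : g (nablaL X e3) e3 = 0.
  by apply: (metric_diag g_sym parallel); rewrite g33 vf_opp vf_1 oppr0.
have dg12 X : g (nablaL X e1) e2 = - g (nablaL X e2) e1.
  by apply: (metric_skew g_sym parallel); rewrite g12 vf_0.
have E12 := torsion_eq0 e1 e2 (torsion0 e1 e2).
have L121 : g (nablaL e1 e2) e1 = a.
  by rewrite E12 bracket12 !gE dg1; ring.
have L211 : g (nablaL e2 e2) e1 = 0.
  apply: oppr_inj; rewrite -dg12; have := dg2 e1.
  by rewrite E12 bracket12 !gE mulr0 mulr0 !subr0 addr0 oppr0.
rewrite !(BDD _ _ D1 D1, BDD _ _ D1 D2, BDD _ _ D2 D1, BDD _ _ D2 D2).
rewrite (BpD _ _ D3 D1) (BpD _ _ D3 D2) (BDp _ _ D1 D3) (BDp _ _ D2 D3).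
rewrite (Bpp _ _ D3 D3) !piDE !piDperpE.
rewrite bracket31 bracket32 bracket13 bracket23.
rewrite !dg1 !dg2 !dg3 !dg12 !L121 !L211 !gE.
by split; [split|split; split]; apply: vfP => h; rewrite !vfE; ring.
Qed.

(** The brackets and the connection have constant coefficients in the frame, so
    all derivative terms vanish and each curvature operator is a commutator of
    constant matrices corrected by the bracket. *)
Lemma bott_curvature_frame :
  [/\ curvature B e1 e2 e1 = (a * b) *: e1 + (a ^+ 2 + b ^+ 2) *: e2,
      curvature B e1 e2 e2 = - (a ^+ 2 + b ^+ 2) *: e1 - (a * b) *: e2
    & curvature B e1 e2 e3 = 0] /\
  [/\ curvature B e1 e3 e1 = (- a ^+ 2 *+ 3) *: e2,
      curvature B e1 e3 e2 = - a ^+ 2 *: e1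
    & curvature B e1 e3 e3 = (a * b) *: e3] /\
  [/\ curvature B e2 e3 e1 = - a ^+ 2 *: e1,
      curvature B e2 e3 e2 = a ^+ 2 *: e2
    & curvature B e2 e3 e3 = - a ^+ 2 *: e3].
Proof.
have [linB _] := B_bott.
have [[B11 B12 B13] [[B21 B22 B23] [B31 B32 B33]]] := bott_frame.
have BE := (connectionE linB, B11, B12, B13, B21, B22, B23, B31, B32, B33).
rewrite /curvature bracket12 bracket13 bracket23.
split; [split|split; split]; rewrite ?BE;
  by apply: vfP => h; rewrite !vfE ?vf_cst; ring.
Qed.

Local Notation ric := (ricci g B e1 e2 e3).
Local Notation rho := (sym_ricci g B e1 e2 e3).

(** The components that enter the quasi-statistical condition on
    [(e1, e3, e1)]. For nonzero [alpha] the Ricci tensor of [B] is not symmetric,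
    as the components on [(e2, e3)] and [(e3, e2)] show. *)
Lemma bott_ricci_frame :
  [/\ ric e1 e1 = - (a ^+ 2 + b ^+ 2), ric e1 e2 = a * b & ric e1 e3 = - a * b]
  /\ [/\ ric e2 e1 = a * b & ric e2 e3 = a ^+ 2]
  /\ [/\ ric e3 e1 = 0 & ric e3 e2 = 0].
Proof.
have [linB _] := B_bott.
have [[R121 R122 R123] [[R131 R132 R133] [R231 R232 R233]]] :=
  bott_curvature_frame.
have RE := (curvature_diag linB, curvature_skew linB e2 e1,
  curvature_skew linB e3 e1, curvature_skew linB e3 e2,
  R121, R122, R123, R131, R132, R133, R231, R232, R233).
rewrite /ricci !RE !gE.
by split; [split|split; split]; ring.
Qed.

(** The frame vectors [(e1, e3, e1)] are chosen because the contributions of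
    [beta] cancel there: on [(e1, e2, e3)] and [(e1, e3, e3)] the expression
    vanishes identically, and on [(e2, e3, e3)] it is a multiple of
    [alpha * (alpha ^+ 2 - beta ^+ 2)], which vanishes if
    [beta ^+ 2 = alpha ^+ 2]. *)
Lemma bott_codazzi_defect :
  covariant_derivative B rho e1 e3 e1 - covariant_derivative B rho e3 e1 e1
    + rho (torsion B e1 e3) e1 = - (3 / 2) *: a ^+ 3.
Proof.
have [linB _] := B_bott.
have [[B11 B12 B13] [_ [B31 B32 B33]]] := bott_frame.
have [[r11 r12 r13] [[r21 r23] [r31 r32]]] := bott_ricci_frame.
have rhoT : tensor02 rho by exact: sym_ricci_tensor.
(* The only scalar left is the 1/2 of the symmetrization, which [ring] then
   treats as an indeterminate. *)
have -> : - (3 / 2) = - (2^-1 + 2^-1 + 2^-1) :> R by field.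
rewrite scaleNr !scalerDl.
rewrite /covariant_derivative /torsion bracket13 B11 B13 B31 !(tensorE rhoT).
rewrite /sym_ricci r11 r12 r13 r21 r23 r31 r32 !smooth_cst_scale.
rewrite !vfE !vf_cst !vf_0.
by ring.
Qed.

End BottConnectionG1.

Theorem theorem3p2 (R : realType) (alpha beta : R) (alpha_neq0 : alpha != 0)
  (G1 : lieGroupType R 3)
  (G1_connected : connected [set: G1])
  (G1_simply_connected : simply_connected R G1)
  (g : vector_field G1 -> vector_field G1 -> smooth_fun G1)
  (g_lorentzian : lorentzian_metric g)
  (g_left_invariant : left_invariant_metric g)
  (e1 e2 e3 : vector_field G1)
  (e_basis : lie_algebra_basis [tuple e1; e2; e3])
  (g11 : g e1 e1 = 1) (g22 : g e2 e2 = 1) (g33 : g e3 e3 = -1)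
  (g12 : g e1 e2 = 0) (g13 : g e1 e3 = 0) (g23 : g e2 e3 = 0)
  (bracket12 : lie_bracket e1 e2 =
     smooth_cst G1 alpha *: e1 - smooth_cst G1 beta *: e3)
  (bracket13 : lie_bracket e1 e3 =
     - (smooth_cst G1 alpha *: e1) - smooth_cst G1 beta *: e2)
  (bracket23 : lie_bracket e2 e3 =
     smooth_cst G1 beta *: e1 + smooth_cst G1 alpha *: e2
       + smooth_cst G1 alpha *: e3)
  (nablaL : vector_field G1 -> vector_field G1 -> vector_field G1)
  (nablaL_levi_civita : levi_civita g nablaL)
  (piD piDperp : vector_field G1 -> vector_field G1)
  (pi_splitting : splitting (span2 e1 e2) (span1 e3) piD piDperp)
  (nablaB : vector_field G1 -> vector_field G1 -> vector_field G1)
  (nablaB_bott :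
     bott_connection (span2 e1 e2) (span1 e3) piD piDperp nablaL nablaB) :
  ~ quasi_statistical nablaB (sym_ricci g nablaB e1 e2 e3).
Proof.
move=> quasi.
have [gT g_sym _] := g_lorentzian.
have := bott_codazzi_defect gT g_sym g11 g22 g33 g12 g13 g23 bracket12 bracket13
  bracket23 nablaL_levi_civita pi_splitting nablaB_bott.
rewrite (quasi e1 e3 e1) => /esym /(congr1 (fun f : smooth_fun G1 => f 1%g)).
rewrite -[LHS]/(- (3 / 2) * smooth_cst G1 alpha 1%g ^+ 3) smooth_cstE.
rewrite -[RHS]/(0 : R) => /eqP.
rewrite mulf_eq0 oppr_eq0 mulf_eq0 invr_eq0 !pnatr_eq0 /= expf_eq0 /=.
by rewrite (negbTE alpha_neq0).
Qed.
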